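(* Let $f:\mathbb{Z}_{\ge0}\to\mathbb{Z}_{\ge0}$ be nondecreasing and suppose that $G_f(\{y,z\})=y\oplus z$ for all $y,z\in\mathbb{Z}_{\ge0}$ with $y\le f(z)$. Then $f$ satisfies condition (a): for all $z,z'\in\mathbb{Z}_{\ge0}$ and every positive integer $i$, if $\lfloor z/2^i\rfloor=\lfloor z'/2^i\rfloor$ then $\lfloor f(z)/2^{i-1}\rfloor=\lfloor f(z')/2^{i-1}\rfloor$.
   Context: $\oplus$ denotes nim-sum (bitwise XOR). For a nondecreasing $f:\mathbb{Z}_{\ge0}\to\mathbb{Z}_{\ge0}$, positions of the chocolate bar game $CB(f,y,z)$ are pairs $\{y,z\}$ of nonnegative integers with $y\le f(z)$ (the bar has $z+1$ columns, column 0 bitter, column $i$ of height $\min(f(i),y)+1$). Moves: $move_f(\{y,z\})=\{\{v,z\}:v<y\}\cup\{\{\min(y,f(w)),w\}:w<z\}$. Grundy number: $G_f(\{y,z\})=\mathrm{mex}\{G_f(p):p\in move_f(\{y,z\})\}$, mex being the least nonnegative integer not in the set. *)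

(* Defs.v *)
From mathcomp Require Import all_boot.

Set Implicit Arguments.
Unset Strict Implicit.
Unset Printing Implicit Defensive.

(* Nim-sum: bitwise exclusive or of the binary expansions. *)
Definition nim_sum (m n : nat) : nat := Nat.lxor m n.

Lemma mex_exists (s : seq nat) : exists n, n \notin s.
Proof.
exists (\max_(m <- s) m).+1; apply/negP => hs.
suff: (\max_(m <- s) m).+1 <= \max_(m <- s) m by rewrite ltnn.
by apply: leq_bigmax_seq hs _.
Qed.

Definition mex (s : seq nat) : nat := ex_minn (mex_exists s).

Section ChocolateBar.

Variable f : nat -> nat.

(* The pair p = (y, z) stands for the bar {y, z}. *)
Definition is_position (p : nat * nat) : bool := p.1 <= f p.2.

Definition moves (p : nat * nat) : seq (nat * nat) :=
  [seq (v, p.2) | v <- iota 0 p.1] ++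
  [seq (minn p.1 (f w), w) | w <- iota 0 p.2].

(* Every move strictly decreases y + z, so (y + z).+1 steps of recursion
   suffice; grundyE below is the defining mex equation.  The function is total
   on pairs, but moves_position shows that positions only lead to positions. *)
Fixpoint grundy_rec (n : nat) (p : nat * nat) : nat :=
  if n is n'.+1 then mex [seq grundy_rec n' q | q <- moves p] else 0.

Definition grundy (p : nat * nat) : nat := grundy_rec (p.1 + p.2).+1 p.

Lemma movesP (p q : nat * nat) :
  reflect ((exists2 v, v < p.1 & q = (v, p.2)) \/
           (exists2 w, w < p.2 & q = (minn p.1 (f w), w)))
          (q \in moves p).
Proof.
rewrite mem_cat; apply: (iffP orP) => -[].
- by case/mapP => v; rewrite mem_iota => hv ->; left; exists v.
- by case/mapP => w; rewrite mem_iota => hw ->; right; exists w.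
- by case=> v hv ->; left; apply: map_f; rewrite mem_iota.
- case=> w hw ->; right.
  by apply: (map_f (fun w => (minn p.1 (f w), w))); rewrite mem_iota.
Qed.

Lemma moves_position (p q : nat * nat) :
  is_position p -> q \in moves p -> is_position q.
Proof.
rewrite /is_position => hp /movesP[[v hv ->]|[w hw ->]] /=.
  exact: leq_trans (ltnW hv) hp.
exact: geq_minr.
Qed.

Lemma moves_decr (p q : nat * nat) : q \in moves p -> q.1 + q.2 < p.1 + p.2.
Proof.
case/movesP => [[v hv ->]|[w hw ->]] /=; first by rewrite ltn_add2r.
by rewrite -addnS leq_add // geq_minl.
Qed.

Lemma grundy_rec_stable (m n : nat) (p : nat * nat) :
  p.1 + p.2 < m -> p.1 + p.2 < n -> grundy_rec m p = grundy_rec n p.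
Proof.
elim: m n p => [|m IHm] [|n] p //= hm hn; congr mex.
apply/eq_in_map => q /moves_decr hq.
by apply: IHm; [exact: leq_trans hq hm | exact: leq_trans hq hn].
Qed.

Lemma grundyE (p : nat * nat) :
  grundy p = mex [seq grundy q | q <- moves p].
Proof.
rewrite {1}/grundy /=; congr mex; apply/eq_in_map => q /moves_decr hq.
exact: grundy_rec_stable.
Qed.

End ChocolateBar.

(* Main.v *)
Require Import Defs.
From Stdlib Require Import PeanoNat.
From mathcomp Require Import all_boot.
From mathcomp Require Import zify.

Set Implicit Arguments.
Unset Strict Implicit.
Unset Printing Implicit Defensive.

(** Write F w := f w (+) w.  No move from {y, z} has value y (+) z, so F w <> y (+) z
whenever w < z and f w < y <= f z; in particular F is injective.  Hence, if F
maps an aligned block of size d into an aligned block of size d, it maps onto it.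

Suppose condition (a) holds below z = (2b + 1) 2^k but f (z - 1) and f z lie in
distinct blocks of size 2^k.  Let a := floor (f (z - 1) / 2^k) and
y := (a + 1) 2^k, so that f w < y <= f z for all w < z; it suffices to find w < z
with F w = y (+) z.  If a is even, the block [2b 2^k, z) is mapped by F onto the
block of size 2^k that contains y (+) z.  If a is odd, then
y (+) 2b 2^k < y (+) z is the value of some move from {y, z}, which must be a
move to a column w < 2b 2^k; the block of size 2^(k+1) around w is mapped by F
onto the block of size 2^(k+1) that contains both y (+) 2b 2^k and y (+) z. *)

Lemma nim_sumC : commutative nim_sum.
Proof. exact: Nat.lxor_comm. Qed.

Lemma nim_sumA : associative nim_sum.
Proof. by move=> m n p; rewrite /nim_sum Nat.lxor_assoc. Qed.

Lemma nim_sumKr p m : nim_sum (nim_sum m p) p = m.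
Proof. by rewrite /nim_sum Nat.lxor_assoc Nat.lxor_nilpotent Nat.lxor_0_r. Qed.

Lemma nim_sumIr p : injective (nim_sum^~ p).
Proof. by apply: (can_inj (g := nim_sum^~ p)) => m; apply: nim_sumKr. Qed.

Lemma nim_sumIl p : injective (nim_sum p).
Proof. by move=> m n; rewrite !(nim_sumC p); apply: nim_sumIr. Qed.

Lemma shiftrE m k : Nat.shiftr m k = m %/ 2 ^ k.
Proof.
elim: k => [|k IHk] /=; first by rewrite divn1.
by rewrite IHk expnSr divnMA divn2; elim/ltn_ind: (_ %/ _) => -[|[|n]] //= ->.
Qed.

Lemma divn_nim_sum m n k :
  nim_sum m n %/ 2 ^ k = nim_sum (m %/ 2 ^ k) (n %/ 2 ^ k).
Proof. by rewrite -!shiftrE /nim_sum Nat.shiftr_lxor. Qed.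

Lemma nim_sum_double1 m : nim_sum m.*2 1 = m.*2.+1.
Proof.
rewrite /nim_sum -Nat.add_nocarry_lxor ?plusE ?addn1 //.
by rewrite -mul2n -[2 * m]/(Nat.mul 2 m) Nat.land_even_l Nat.land_0_r.
Qed.

Lemma nim_sum_double m n : nim_sum m.*2 n.*2 = (nim_sum m n).*2.
Proof.
have shiftl1 p : Nat.shiftl p 1 = p.*2 by rewrite /= /Nat.double plusE addnn.
by rewrite -!shiftl1 /nim_sum Nat.shiftl_lxor.
Qed.

(** Pigeonhole: both blocks have exactly [d] elements, so an injective map from one into the other
    is onto. *)
Lemma block_surj (F : nat -> nat) d c e x : 0 < d -> injective F ->
    (forall w, w %/ d = c -> F w %/ d = e) -> x %/ d = e ->
  exists2 w, w %/ d = c & F w = x.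
Proof.
move=> d_gt0 Finj Fce xe.
have blockP u v : (v \in iota (u * d) d) = (v %/ d == u).
  rewrite mem_iota eqn_leq leq_divRL // -(ltnS (v %/ d)) ltn_divLR //.
  by rewrite mulSn addnC andbC.
have sFi : {subset map F (iota (c * d) d) <= iota (e * d) d}.
  by move=> _ /mapP[w + ->]; rewrite !blockP => /eqP/Fce->.
have [||_ eqFi] := uniq_min_size _ sFi.
- by rewrite map_inj_uniq ?iota_uniq.
- by rewrite size_map !size_iota.
have: x \in map F (iota (c * d) d) by rewrite eqFi blockP xe.
by case/mapP=> w; rewrite blockP => /eqP wc ->; exists w.
Qed.

Lemma odd_halfS_neq m n : odd m -> n <= m -> n %/ 2 <> m.+1 %/ 2.
Proof. by move=> m_odd nm /eqP; apply/negP; rewrite !divn2; lia. Qed.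

Lemma mex_notin s : mex s \notin s.
Proof. by rewrite /mex; case: ex_minnP. Qed.

Lemma lt_mex s n : n < mex s -> n \in s.
Proof.
rewrite /mex; case: ex_minnP => m _ min_m; rewrite ltnNge.
by apply: contraR => /min_m.
Qed.

Section NimSumGrundy.

Variable f : nat -> nat.
Hypothesis f_nondecreasing : {homo f : m n / m <= n}.
Hypothesis grundy_xor : forall y z : nat, is_position f (y, z) ->
  grundy f (y, z) = nim_sum y z.

Lemma nim_sum_moves y z : y <= f z ->
  nim_sum y z = mex [seq nim_sum q.1 q.2 | q <- moves f (y, z)].
Proof.
move=> yz; rewrite -grundy_xor // grundyE; congr mex.
have pos_yz : is_position f (y, z) by [].
by apply/eq_in_map => -[v w] /(moves_position pos_yz); apply: grundy_xor.
Qed.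

(** Since [f w < y], moving to column [w] leaves [(f w, w)], and a mex differs from the value of
    every option. *)
Lemma column_avoid y z w : y <= f z -> w < z -> f w < y ->
  nim_sum (f w) w <> nim_sum y z.
Proof.
move=> yz wz fwy eqF.
have := mex_notin [seq nim_sum q.1 q.2 | q <- moves f (y, z)].
rewrite -nim_sum_moves // -eqF => /mapP[]; exists (f w, w) => //.
by apply/movesP; right; exists w; rewrite // (minn_idPr (ltnW fwy)).
Qed.

Lemma move_reach y z x : y <= f z -> x < nim_sum y z ->
  (exists2 v, v < y & nim_sum v z = x) \/
  (exists2 w, w < z & nim_sum (minn y (f w)) w = x).
Proof.
move=> yz; rewrite nim_sum_moves // => /lt_mex/mapP[q /movesP] /= [].
  by case=> v vy -> ->; left; exists v.
by case=> w wz -> ->; right; exists w.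
Qed.

(** For [w < z], either [f w < f z] and the previous fact applies with [y = f z], or the heights
    agree and cancel. *)
Lemma column_inj : injective (fun w => nim_sum (f w) w).
Proof.
move=> w z; wlog wz: w z / w < z.
  by move=> IH; case: (ltngtP w z) => // h e; [|symmetry]; apply: IH.
move=> eqF; have := f_nondecreasing (ltnW wz); rewrite leq_eqVlt.
case/predU1P=> [efwz | fwz]; last by case: (column_avoid (leqnn _) wz fwz eqF).
by move: eqF; rewrite efwz => /nim_sumIl.
Qed.

Definition stable_below z := forall w w' i, w < z -> w' < z ->
  w %/ 2 ^ i.+1 = w' %/ 2 ^ i.+1 -> f w %/ 2 ^ i = f w' %/ 2 ^ i.

(** Here [k] is the 2-adic valuation of [z]; this is the only comparison with a new column that the
    induction in [stable_all] needs. *)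
Lemma stable_step b k (z := b.*2.+1 * 2 ^ k) :
  stable_below z -> f z.-1 %/ 2 ^ k = f z %/ 2 ^ k.
Proof.
have d_gt0: 0 < 2 ^ k by rewrite expn_gt0.
have z_gt0 : 0 < z by rewrite muln_gt0.
move=> stab; apply/eqP; rewrite eqn_leq leq_div2r ?f_nondecreasing ?leq_pred //=.
rewrite leqNgt; apply/negP; set a := f z.-1 %/ 2 ^ k => a_lt.
pose y := a.+1 * 2 ^ k.
have yz : y <= f z by rewrite /y -leq_divRL.
have fwy w : w < z -> f w < y.
  move=> wz; apply: leq_ltn_trans (_ : f z.-1 < _).
    by apply: f_nondecreasing; rewrite -ltnS prednK.
  by rewrite /y -ltn_divLR.
have missed w : w < z -> nim_sum (f w) w <> nim_sum y z.
  by move=> wz; apply: column_avoid => //; apply: fwy.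
have y_div : y %/ 2 ^ k = a.+1 by rewrite /y mulnK.
have z_div : z %/ 2 ^ k = b.*2.+1 by rewrite /z mulnK.
have yz_div : nim_sum y z %/ 2 ^ k = nim_sum (nim_sum a.+1 1) b.*2.
  by rewrite divn_nim_sum y_div z_div -nim_sum_double1 -nim_sumA (nim_sumC 1).
have lt_z w u : w %/ 2 ^ k = u -> u < b.*2.+1 -> w < z.
  by move=> <-; rewrite ltn_divLR.
have [a_odd | a_even] := boolP (odd a); last first.
  (* For even [a], the two terms 1 cancel, so the target block has index [nim_sum a b.*2]. *)
  have Ea : a.+1 = nim_sum a 1 by rewrite -(even_halfK a_even) nim_sum_double1.
  have [|w wc Fw] := block_surj d_gt0 column_inj _
    (erefl : nim_sum y z %/ 2 ^ k = _) (c := b.*2).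
    move=> w wc; rewrite yz_div Ea nim_sumKr divn_nim_sum wc; congr nim_sum.
    apply: stab; rewrite ?prednK //; first by apply: lt_z wc _.
    have z1_div : z.-1 %/ 2 ^ k = b.*2.
      apply/eqP; rewrite eqn_leq -ltnS ltn_divLR // leq_divRL //.
      rewrite -/z prednK // leqnn /= -ltnS prednK // /z mulSn.
      by rewrite -[X in X < _]add0n ltn_add2r.
    by rewrite expnSr !divnMA wc z1_div.
  by apply: (missed w) => //; apply: lt_z wc _.
(* [x] is [nim_sum y z] with bit [k] cleared: this bit is 1 in [z] and 0 in [y], because [a.+1] is
   even. *)
pose x := nim_sum y (b.*2 * 2 ^ k).
have x_div : x %/ 2 ^ k = nim_sum a.+1 b.*2.
  by rewrite divn_nim_sum y_div mulnK.
have Ea : nim_sum a.+1 1 = a.+2.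
  by have a1_even: ~~ odd a.+1 by [rewrite /= a_odd];
     rewrite -(even_halfK a1_even) nim_sum_double1.
have half_div m : m %/ 2 ^ k.+1 = m %/ 2 ^ k %/ 2 by rewrite expnSr divnMA.
have b_half : b.*2.+1 %/ 2 = b by rewrite divn2 /= uphalf_double.
have x_div1 : x %/ 2 ^ k.+1 = nim_sum y z %/ 2 ^ k.+1.
  rewrite !divn_nim_sum; congr nim_sum.
  by rewrite !half_div z_div mulnK // b_half divn2 doubleK.
have x_lt : x < nim_sum y z.
  rewrite ltnNge; apply/negP => /(leq_div2r (2 ^ k)).
  rewrite x_div yz_div -nim_sumA (nim_sumC 1) nim_sumA leqNgt.
  have -> : a.+1 = (a.+1)./2.*2 by rewrite even_halfK ?negbK //= a_odd.
  by rewrite nim_sum_double nim_sum_double1 ltnS leqnn.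
case: (move_reach yz x_lt) => [[v vy] | [w wz]].
  (* Lowering the height to [v] would force [v %/ 2 ^ k = a.+2], contradicting [v < y]. *)
  move/(congr1 (divn^~ (2 ^ k))); rewrite x_div divn_nim_sum z_div.
  rewrite -nim_sum_double1 (nim_sumC b.*2) nim_sumA => /nim_sumIr.
  move/(congr1 (nim_sum^~ 1)); rewrite nim_sumKr Ea => Ev.
  by have := leq_div2r (2 ^ k) (ltnW vy); rewrite Ev y_div ltnn.
rewrite (minn_idPr (ltnW (fwy _ wz))) => Fw.
(* If [w] shares the block of size [2 ^ k.+1] of [z], then [f w] must share that of [y]; but
   [f w %/ 2 ^ k <= a] and, [a] being odd, [a.+1] opens a new pair. *)
have [w_ge|w_lt] := leqP b (w %/ 2 ^ k.+1).
  have w_div : w %/ 2 ^ k.+1 = b.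
    apply/eqP; rewrite eqn_leq w_ge andbT half_div -[X in _ <= X]b_half -z_div.
    by rewrite !leq_div2r // ltnW.
  have := congr1 (divn^~ (2 ^ k.+1)) Fw.
  rewrite x_div1 !divn_nim_sum w_div [z %/ _]half_div z_div b_half.
  move/nim_sumIr; rewrite !half_div y_div; apply: odd_halfS_neq => //.
  by rewrite -ltnS ltn_divLR // fwy.
have block_lt_z w' : w' %/ 2 ^ k.+1 = w %/ 2 ^ k.+1 -> w' < z.
  move=> w'c; apply: lt_z (erefl _) _.
  by move: w_lt; rewrite -w'c half_div ltn_divLR // muln2 => /ltnW.
have [||w' w'c Fw'] := block_surj _ column_inj _ (esym x_div1)
  (c := w %/ 2 ^ k.+1); first by rewrite expn_gt0.
  move=> w' w'c; rewrite -Fw !divn_nim_sum w'c !(half_div (f _)).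
  by congr (nim_sum (_ %/ _) _); apply: stab => //; apply: block_lt_z.
by apply: (missed w') Fw'; apply: block_lt_z.
Qed.

Lemma stable_all z : stable_below z.
Proof.
elim: z => [|z IHz] // w w' i.
wlog: w w' / w <= w'.
  move=> IH hw hw' e.
  by case: (leqP w w') => [|/ltnW] h; [|symmetry]; apply: IH.
rewrite !ltnS => ww' _ w'z e.
move: w'z; rewrite leq_eqVlt => /predU1P[Ew'|w'z]; last first.
  by apply: IHz e => //; apply: leq_ltn_trans ww' w'z.
move: ww'; rewrite leq_eqVlt => /predU1P[-> //|ww']; rewrite {}Ew' in e ww' *.
have z_gt0: 0 < z by apply: leq_ltn_trans ww'.
(* As [w <= z.-1 < z], the column [z.-1] lies in the same block, so only [z.-1] and [z] remain to be
   compared. *)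
have e1 : w %/ 2 ^ i.+1 = z.-1 %/ 2 ^ i.+1.
  apply/eqP; rewrite eqn_leq {2}e !leq_div2r ?leq_pred //.
  by rewrite -ltnS prednK.
rewrite (IHz _ _ _ _ _ e1) ?prednK //.
have := pfactor_coprime (isT : prime 2) z_gt0.
case=> m; rewrite coprime2n => m_odd Ez; set k := logn 2 z in Ez.
have Em : m = m./2.*2.+1 by rewrite -[LHS]odd_double_half m_odd.
(* Otherwise [z] would be the first element of its block of size [2 ^ i.+1], which contains the
   smaller [w]. *)
have ki : k <= i.
  rewrite leqNgt; apply/negP => ik.
  have : w < z %/ 2 ^ i.+1 * 2 ^ i.+1.
    by rewrite divnK // Ez dvdn_mull // dvdn_exp2l.
  by rewrite -e ltnNge leq_trunc_div.
have := @stable_step m./2 k; rewrite -Em -Ez => /(_ IHz) H.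
(* Equality of quotients by [2 ^ k] passes to the coarser [2 ^ i]. *)
by rewrite -(subnKC ki) expnD !divnMA H.
Qed.

End NimSumGrundy.

Theorem mainTheorem2 (f : nat -> nat)
  (f_nondecreasing : {homo f : m n / m <= n})
  (grundy_xor : forall y z : nat, is_position f (y, z) ->
     grundy f (y, z) = nim_sum y z) :
  forall z z' i : nat, 0 < i ->
    z %/ 2 ^ i = z' %/ 2 ^ i ->
    f z %/ 2 ^ i.-1 = f z' %/ 2 ^ i.-1.
Proof.
move=> z z' [|i] // _.
by apply: (stable_all f_nondecreasing grundy_xor (z := (maxn z z').+1));
  rewrite // ltnS ?leq_maxl ?leq_maxr.
Qed.
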